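(* For a real number $x:\mathbb{R}_D$, locators and signed-digit representations are interdefinable: there are functions $\operatorname{locator}(x)\to\operatorname{SDR}(x)$ and $\operatorname{SDR}(x)\to\operatorname{locator}(x)$, where $\operatorname{SDR}(x)$ is the type of signed-digit representations of $x$.
   Context: Work in Martin-Löf type theory with propositional truncation, function extensionality and propositional extensionality. A Dedekind real is a pair $x=(L,U)$ of proposition-valued predicates on $\mathbb{Q}$, writing $q<x$ for $q\in L$ and $x<r$ for $r\in U$, which is bounded, rounded, transitive and located ($q<r\Rightarrow\|(q<x)+(x<r)\|$). $\mathbb{R}_D$ is the type of Dedekind reals. A locator for $x$ is a function $\prod_{q,r:\mathbb{Q}}(q<r)\to(q<x)+(x<r)$ into the untruncated disjoint sum; $\operatorname{locator}(x)$ is the type of locators. A signed-digit representation of $x$ consists of $k:\mathbb{Z}$ and a sequence $a:\mathbb{N}\to\{-9,-8,\dots,-1,0,1,\dots,9\}$ such that $x=k+\sum_{i=0}^\infty a_i\cdot 10^{-i-1}$; $\operatorname{SDR}(x)$ is the type of such pairs $(k,a)$ together with a proof of this equation. *)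

(* Defs.v *)
From HB Require Import structures.
From mathcomp Require Import all_boot all_order all_algebra.
From mathcomp Require Import ring lra zify.

Set Implicit Arguments.
Unset Strict Implicit.
Unset Printing Implicit Defensive.

Import Order.TTheory GRing.Theory Num.Theory.
Local Open Scope ring_scope.

(* Propositions are rendered by Prop, so the truncated disjunction and the     *)
(* truncated existential are [\/] and [exists]; data are kept in Type.         *)
Record dedekind : Type := Dedekind {
  lcut : rat -> Prop;   (* q < x *)
  ucut : rat -> Prop;   (* x < r *)
  lcut_bounded : exists q, lcut q;
  ucut_bounded : exists r, ucut r;
  lcut_rounded : forall q, lcut q <-> exists2 q', q < q' & lcut q';
  ucut_rounded : forall r, ucut r <-> exists2 r', r' < r & ucut r';
  cut_transitive : forall q r, lcut q -> ucut r -> q < r;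
  cut_located : forall q r, q < r -> lcut q \/ ucut r
}.

(* [{A} + {B}] is the untruncated sum: it can be eliminated into any type.     *)
Definition locator (x : dedekind) : Type :=
  forall q r : rat, q < r -> {lcut x q} + {ucut x r}.

Lemma lcut_le (x : dedekind) q q' : q <= q' -> lcut x q' -> lcut x q.
Proof.
rewrite le_eqVlt => /orP[/eqP->//|lt_qq' Lq'].
by apply/(lcut_rounded x q); exists q'.
Qed.

Lemma ucut_le (x : dedekind) r r' : r' <= r -> ucut x r' -> ucut x r.
Proof.
rewrite le_eqVlt => /orP[/eqP<-//|lt_r'r Ur'].
by apply/(ucut_rounded x r); exists r'.
Qed.

Lemma cut_approx (x : dedekind) (e : rat) :
  0 < e -> exists2 q, lcut x q & ucut x (q + e).
Proof.
move=> e_gt0.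
have steps n : forall q, lcut x q -> ucut x (q + n%:R * (e / 2)) ->
    exists2 q, lcut x q & ucut x (q + e).
  elim: n => [|n IHn] q Lq Uq.
    by move: (cut_transitive Lq Uq); rewrite mul0r addr0 ltxx.
  have lt_q : q + e / 2 < q + e by lra.
  case: (cut_located x lt_q) => [Lq'|Uq']; last by exists q.
  apply: (IHn _ Lq'); move: Uq; rewrite -natr1.
  by congr (ucut x _); ring.
have [q Lq] := lcut_bounded x; have [r Ur] := ucut_bounded x.
have lt_qr := cut_transitive Lq Ur.
have e2_gt0 : 0 < e / 2 by lra.
have d_ge0 : 0 <= (r - q) / (e / 2) by apply: divr_ge0; lra.
have := archi_boundP d_ge0; set n := Num.bound _ => lt_n.
apply: (steps n q Lq); apply: ucut_le Ur.
by move: lt_n; rewrite ltr_pdivrMr //; lra.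
Qed.

Section RatD.
Variable p : rat.

Fact ratD_bl : exists q, q < p. Proof. by exists (p - 1); lra. Qed.
Fact ratD_bu : exists r, p < r. Proof. by exists (p + 1); lra. Qed.
Fact ratD_rl q : q < p <-> exists2 q', q < q' & q' < p.
Proof.
split=> [lt_qp|[q' lt1 lt2]]; last exact: lt_trans lt2.
by exists ((q + p) / 2); lra.
Qed.
Fact ratD_ru r : p < r <-> exists2 r', r' < r & p < r'.
Proof.
split=> [lt_pr|[q' lt1 lt2]]; last exact: lt_trans lt1.
by exists ((r + p) / 2); lra.
Qed.
Fact ratD_tr q r : q < p -> p < r -> q < r. Proof. exact: lt_trans. Qed.
Fact ratD_lo q r : q < r -> q < p \/ p < r.
Proof. by move=> lt_qr; case: (ltP q p) => ?; [left|right; lra]. Qed.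

Definition ratD : dedekind :=
  @Dedekind (fun q => q < p) (fun r => p < r)
    ratD_bl ratD_bu ratD_rl ratD_ru ratD_tr ratD_lo.

End RatD.

Section AddD.
Variables x y : dedekind.

Definition addD_lcut (q : rat) : Prop :=
  exists a b, [/\ lcut x a, lcut y b & q = a + b].
Definition addD_ucut (r : rat) : Prop :=
  exists a b, [/\ ucut x a, ucut y b & r = a + b].

Fact addD_bl : exists q, addD_lcut q.
Proof.
have [a La] := lcut_bounded x; have [b Lb] := lcut_bounded y.
by exists (a + b), a, b.
Qed.
Fact addD_bu : exists r, addD_ucut r.
Proof.
have [a Ua] := ucut_bounded x; have [b Ub] := ucut_bounded y.
by exists (a + b), a, b.
Qed.
Fact addD_rl q : addD_lcut q <-> exists2 q', q < q' & addD_lcut q'.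
Proof.
split=> [[a [b [La Lb ->]]]|[q' lt_q [a [b [La Lb eq_q']]]]].
  have [a' lt_a La'] := (lcut_rounded x a).1 La.
  by exists (a' + b); [lra|exists a', b].
exists (q - b), b; split=> //; last by ring.
by apply: lcut_le La; lra.
Qed.
Fact addD_ru r : addD_ucut r <-> exists2 r', r' < r & addD_ucut r'.
Proof.
split=> [[a [b [Ua Ub ->]]]|[r' lt_r [a [b [Ua Ub eq_r']]]]].
  have [a' lt_a Ua'] := (ucut_rounded x a).1 Ua.
  by exists (a' + b); [lra|exists a', b].
exists (r - b), b; split=> //; last by ring.
by apply: ucut_le Ua; lra.
Qed.
Fact addD_tr q r : addD_lcut q -> addD_ucut r -> q < r.
Proof.
move=> [a [b [La Lb ->]]] [c [d [Uc Ud ->]]].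
by have := cut_transitive La Uc; have := cut_transitive Lb Ud; lra.
Qed.
Fact addD_lo q r : q < r -> addD_lcut q \/ addD_ucut r.
Proof.
move=> lt_qr; have e_gt0 : 0 < (r - q) / 2 by lra.
have [a La Ua] := cut_approx x e_gt0.
have lt_y : q - a < q - a + (r - q) / 2 by lra.
case: (cut_located y lt_y) => [Lb|Ub].
  by left; exists a, (q - a); split=> //; ring.
by right; exists (a + (r - q) / 2), (q - a + (r - q) / 2); split=> //; lra.
Qed.

Definition addD : dedekind :=
  Dedekind addD_bl addD_bu addD_rl addD_ru addD_tr addD_lo.

End AddD.

Definition cauchy_rat (s : nat -> rat) : Prop :=
  forall e : rat, 0 < e ->
    exists N : nat, forall m n, (N <= m)%N -> (N <= n)%N -> `|s m - s n| < e.

Section LimD.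
Variables (s : nat -> rat) (cauchy_s : cauchy_rat s).

(* q < lim s iff s eventually stays above some q' > q, and dually.             *)
Definition limD_lcut (q : rat) : Prop :=
  exists2 q', q < q' & exists N : nat, forall n, (N <= n)%N -> q' < s n.
Definition limD_ucut (r : rat) : Prop :=
  exists2 r', r' < r & exists N : nat, forall n, (N <= n)%N -> s n < r'.

Fact limD_near (e : rat) : 0 < e ->
  exists N : nat, forall n, (N <= n)%N -> s N - e < s n /\ s n < s N + e.
Proof.
move=> /cauchy_s[N sN]; exists N => n le_Nn.
have := sN n N le_Nn (leqnn N); rewrite ltr_norml => /andP[? ?].
by split; lra.
Qed.

Fact limD_bl : exists q, limD_lcut q.
Proof.
have [N sN] := limD_near (ltr01 : 0 < 1 :> rat).
exists (s N - 2), (s N - 1); first by lra.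
by exists N => n /sN[].
Qed.
Fact limD_bu : exists r, limD_ucut r.
Proof.
have [N sN] := limD_near (ltr01 : 0 < 1 :> rat).
exists (s N + 2), (s N + 1); first by lra.
by exists N => n /sN[].
Qed.
Fact limD_rl q : limD_lcut q <-> exists2 q', q < q' & limD_lcut q'.
Proof.
split=> [[q' lt_q sq']|[q' lt_q [q'' lt_q' sq'']]].
  by exists ((q + q') / 2); [lra|exists q' => //; lra].
by exists q'' => //; apply: lt_trans lt_q'.
Qed.
Fact limD_ru r : limD_ucut r <-> exists2 r', r' < r & limD_ucut r'.
Proof.
split=> [[r' lt_r sr']|[r' lt_r [r'' lt_r' sr'']]].
  by exists ((r + r') / 2); [lra|exists r' => //; lra].
by exists r'' => //; apply: lt_trans lt_r.
Qed.
Fact limD_tr q r : limD_lcut q -> limD_ucut r -> q < r.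
Proof.
move=> [q' lt_q [N sN]] [r' lt_r [M sM]].
have := sN _ (leq_maxl N M); have := sM _ (leq_maxr N M); lra.
Qed.
Fact limD_lo q r : q < r -> limD_lcut q \/ limD_ucut r.
Proof.
move=> lt_qr; have e_gt0 : 0 < (r - q) / 4 by lra.
have [N sN] := limD_near e_gt0.
case: (leP ((q + r) / 2) (s N)) => cmp; [left|right].
  exists ((q + r) / 2 - (r - q) / 4); first by lra.
  by exists N => n /sN[? ?]; lra.
exists ((q + r) / 2 + (r - q) / 4); first by lra.
by exists N => n /sN[? ?]; lra.
Qed.

Definition limD : dedekind :=
  Dedekind limD_bl limD_bu limD_rl limD_ru limD_tr limD_lo.

(* [limD] is the limit of s in the usual sense: |s n - limD| < e eventually.   *)
Lemma limD_cvg (e : rat) : 0 < e ->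
  exists N : nat, forall n, (N <= n)%N ->
    lcut limD (s n - e) /\ ucut limD (s n + e).
Proof.
move=> e_gt0; have e2_gt0 : 0 < e / 4 by lra.
have [N sN] := limD_near e2_gt0; exists N => n /sN[lt1 lt2]; split.
  exists (s N - e / 4); first by lra.
  by exists N => m /sN[].
exists (s N + e / 4); first by lra.
by exists N => m /sN[].
Qed.

End LimD.

Definition digit : Type := {d : int | -9 <= d <= 9}.

Definition digit_psum (a : nat -> digit) (n : nat) : rat :=
  \sum_(i < n) (val (a i))%:~R / 10 ^+ i.+1.

Lemma digit_psum_tail a n k :
  `|digit_psum a (n + k) - digit_psum a n| <= 10 ^- n - 10 ^- (n + k).
Proof.
elim: k => [|k IHk]; first by rewrite addn0 !subrr normr0.
rewrite addnS /digit_psum big_ord_recr /= -/(digit_psum a _) -/(digit_psum a n).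
have p_gt0 : 0 < 10 ^+ (n + k) :> rat by apply: exprn_gt0.
set c : rat := _%:~R.
have /andP[c1 c2] : -9 <= c <= 9.
  rewrite /c; case: (a _) => d /= /andP[d1 d2].
  by rewrite -[9]/(9%:~R) -[- 9%:~R]/((-9)%:~R) !ler_int d1.
have i_gt0 : 0 < (10 ^+ (n + k))^-1 :> rat by rewrite invr_gt0.
have eq10 : (10 ^+ (n + k).+1)^-1 = (10 ^+ (n + k))^-1 / 10 :> rat.
  by rewrite exprSr invfM mulrC.
move: IHk; rewrite eq10 !ler_norml => /andP[? ?].
by apply/andP; split; nra.
Qed.

Lemma digit_psum_cauchy a : cauchy_rat (digit_psum a).
Proof.
move=> e e_gt0; have ie_ge0 : 0 <= 2 / e by apply: divr_ge0; lra.
have [N lt_N] : exists N : nat, 2 / e < N%:R.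
  by exists (Num.bound (2 / e)); apply: archi_boundP.
have lt10 : 10 ^- N * 2 < e.
  have p_gt0 : 0 < 10 ^+ N :> rat by apply: exprn_gt0.
  rewrite mulrC ltr_pdivrMr //.
  have lt_pow : N%:R < 10 ^+ N :> rat by rewrite -natrX ltr_nat ltn_expl.
  have : 2 / e < 10 ^+ N by apply: lt_trans lt_pow.
  by rewrite ltr_pdivrMr // [_ * e]mulrC.
have near n : (N <= n)%N -> `|digit_psum a n - digit_psum a N| <= 10 ^- N.
  move=> /subnKC <-; apply: (le_trans (digit_psum_tail _ _ _)).
  by rewrite gerBl invr_ge0 exprn_ge0.
exists N => m n /near + /near; move: lt10; rewrite !ler_norml ltr_norml.
move: (10 ^- N) (digit_psum a m) (digit_psum a n) (digit_psum a N) => t u v w.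
by move=> ? /andP[? ?] /andP[? ?]; apply/andP; split; lra.
Qed.

(* sum_{i >= 0} a_i * 10^(-i-1), as a Dedekind real *)
Definition digit_sum (a : nat -> digit) : dedekind :=
  limD (@digit_psum_cauchy a).

Record SDR (x : dedekind) : Type := MkSDR {
  sdr_int : int;
  sdr_digit : nat -> digit;
  sdr_eq : x = addD (ratD sdr_int%:~R) (digit_sum sdr_digit)
}.

(* Main.v *)
(** From a locator, the digits are read off greedily: once [s] is known with
    [s - 10^-n < x < s + 10^-n], at most eighteen calls to the locator, at
    consecutive multiples of [10^-(n+1)], shrink this interval to one of the
    overlapping intervals [s + (d - 1) 10^-(n+1) < x < s + (d + 1) 10^-(n+1)]
    with [d] a signed digit.  The integer part is found in the same way, after
    an unbounded search for integer bounds, which terminates since [x] is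
    bounded.  Conversely, a partial sum within [(r - q) / 4] of the value is a
    rational whose comparison with [(q + r) / 2] decides between [q < x] and
    [x < r]. *)
From mathcomp Require Import all_boot all_order all_algebra.
From mathcomp Require Import ring lra zify.
From mathcomp Require Import boolp.
Require Import Defs.

Set Implicit Arguments.
Unset Strict Implicit.
Unset Printing Implicit Defensive.

Import Order.TTheory GRing.Theory Num.Theory.
Local Open Scope ring_scope.

(** One-sided inclusions suffice: after rounding, locatedness of [x] yields the converse, since the
    wrong alternative would contradict transitivity in [y]. *)
Lemma dedekind_sub_eq (x y : dedekind) :
  (forall q, lcut x q -> lcut y q) -> (forall r, ucut x r -> ucut y r) -> x = y.
Proof.
move=> Lxy Uxy.
have Lyx q : lcut y q -> lcut x q.
  move=> /(lcut_rounded y q)[q' lt_q Lq'].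
  case: (cut_located x lt_q) => // /Uxy Uq'.
  by have := cut_transitive Lq' Uq'; rewrite ltxx.
have Uyx r : ucut y r -> ucut x r.
  move=> /(ucut_rounded y r)[r' lt_r Ur'].
  case: (cut_located x lt_r) => // /Lxy Lr'.
  by have := cut_transitive Lr' Ur'; rewrite ltxx.
have eqL : lcut x = lcut y by apply: funext => q; apply: propext; split; auto.
have eqU : ucut x = ucut y by apply: funext => q; apply: propext; split; auto.
case: x y eqL eqU {Lxy Uxy Lyx Uyx} => [Lx Ux ? ? ? ? ? ?] [Ly Uy ? ? ? ? ? ?].
move=> /= eqL eqU; subst Ly Uy.
by congr Dedekind; apply: Prop_irrelevance.
Qed.

Lemma lcut_addD_limD p s (cs : cauchy_rat s) q q' N :
  q < q' -> (forall n, (N <= n)%N -> q' < p + s n) ->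
  lcut (addD (ratD p) (limD cs)) q.
Proof.
(* Half of the gap [q' - q] puts the first summand strictly below [p]; the other half stays as slack
   for the limit. *)
move=> lt_q sN; exists (p - (q' - q) / 2), (q - p + (q' - q) / 2).
split; [rewrite /=; lra| |ring].
exists (q' - p); first by lra.
by exists N => n /sN; lra.
Qed.

Lemma ucut_addD_limD p s (cs : cauchy_rat s) r r' N :
  r' < r -> (forall n, (N <= n)%N -> p + s n < r') ->
  ucut (addD (ratD p) (limD cs)) r.
Proof.
move=> lt_r sN; exists (p + (r - r') / 2), (r - p - (r - r') / 2).
split; [rewrite /=; lra| |ring].
exists (r' - p); first by lra.
by exists N => n /sN; lra.
Qed.

(** A sigma type, because [SDR_locator] computes its answer from [N]. *)
Lemma ltr_exp10 (e : rat) :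
  0 < e -> {N : nat | forall n, (N <= n)%N -> 10 ^- n < e}.
Proof.
move=> e_gt0; exists (Num.bound e^-1) => n le_n.
have ie_ge0 : 0 <= e^-1 by rewrite invr_ge0 ltW.
rewrite invf_plt ?posrE ?exprn_gt0 //.
apply: lt_le_trans (archi_boundP ie_ge0) _.
rewrite -natrX ler_nat; apply: leq_trans le_n _.
exact/ltnW/ltn_expl.
Qed.

Lemma digit_psum_near a N n :
  (N <= n)%N -> `|digit_psum a n - digit_psum a N| <= 10 ^- N.
Proof.
move=> /subnKC <-; apply: le_trans (digit_psum_tail _ _ _) _.
by rewrite gerBl invr_ge0 exprn_ge0.
Qed.

Lemma SDR_locator (x : dedekind) : SDR x -> locator x.
Proof.
case=> k a -> q r lt_qr.
have e_gt0 : 0 < (r - q) / 4 by lra.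
have [N /(_ N (leqnn N)) small] := ltr_exp10 e_gt0.
have near n : (N <= n)%N ->
    digit_psum a N - 10 ^- N <= digit_psum a n <= digit_psum a N + 10 ^- N.
  by move=> /(digit_psum_near a); rewrite ler_norml; lra.
case: (leP ((q + r) / 2) (k%:~R + digit_psum a N)) => cmp; [left|right].
  apply: (@lcut_addD_limD _ _ _ _ (q + (r - q) / 4) N); first by lra.
  by move=> n /near; lra.
apply: (@ucut_addD_limD _ _ _ _ (r - (r - q) / 4) N); first by lra.
by move=> n /near; lra.
Qed.

Section LocatorToSDR.
Variables (x : dedekind) (loc : locator x).

(** The cut itself need not be decidable, but the answer of the locator is a boolean, so mere
    existence of a bound can be turned into data by [ex_minn]. Once [- n%:R] lies below a known
    lower bound, the answer is forced. *)
Lemma locator_lower : {n : nat | lcut x (- n%:R - 1)}.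
Proof.
have lt_n (n : nat) : - n%:R - 1 < - n%:R :> rat by lra.
pose P n : bool := loc (lt_n n).
have exP : exists n, P n.
  have [q Lq] := lcut_bounded x.
  exists (Num.bound q); rewrite /P; case: (loc _) => //= Uq.
  have := cut_transitive Lq Uq.
  have := archi_boundP (normr_ge0 q); have := ler_norm (- q).
  by rewrite normrN /Num.bound normr_id; lra.
exists (ex_minn exP); case: ex_minnP => n; rewrite /P.
by case: (loc _).
Qed.

Lemma locator_upper : {n : nat | ucut x (n%:R + 1)}.
Proof.
have lt_n (n : nat) : n%:R < n%:R + 1 :> rat by lra.
pose P n : bool := ~~ loc (lt_n n).
have exP : exists n, P n.
  have [r Ur] := ucut_bounded x.
  exists (Num.bound r); rewrite /P; case: (loc _) => //= Lr.
  have := cut_transitive Lr Ur.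
  have := archi_boundP (normr_ge0 r); have := ler_norm r.
  by rewrite /Num.bound normr_id; lra.
exists (ex_minn exP); case: ex_minnP => n; rewrite /P.
by case: (loc _).
Qed.

(** Each call tests the last step of length [e]: either the final two steps already enclose [x], or
    the right end moves down by one step. *)
Lemma locator_refine (c e : rat) n : 0 < e ->
  lcut x c -> ucut x (c + n.+2%:R * e) ->
  {j : nat | (j <= n)%N &
    lcut x (c + j%:R * e) /\ ucut x (c + j.+2%:R * e)}.
Proof.
move=> e_gt0 Lc; elim: n => [|n IHn] Uc.
  by exists 0%N => //; rewrite mul0r addr0.
have lt_n : c + n.+1%:R * e < c + n.+2%:R * e.
  by rewrite ltrD2l ltr_pM2r // ltr_nat.
case: (loc lt_n) => [Ln|/IHn[j le_j ?]]; first by exists n.+1.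
by exists j => //; apply: leqW.
Qed.

Definition near_cut (n : nat) (s : rat) : Prop :=
  lcut x (s - 10 ^- n) /\ ucut x (s + 10 ^- n).

Lemma locator_int : {k : int | near_cut 0 k%:~R}.
Proof.
have [m Lm] := locator_lower; have [n Un] := locator_upper.
have Un' : ucut x (- m%:R - 1 + (m + n).+2%:R * 1).
  by move: Un; congr ucut; rewrite -!natr1 natrD; ring.
have [j _ [Lj Uj]] := locator_refine ltr01 Lm Un'.
exists (j%:Z - m%:Z); rewrite /near_cut expr0 invr1 intrB -!pmulrn.
split; [move: Lj|move: Uj]; congr (_ x _); rewrite -?natr1; ring.
Qed.

Lemma locator_digit n s : near_cut n s ->
  {d : digit | near_cut n.+1 (s + (val d)%:~R / 10 ^+ n.+1)}.
Proof.
case=> Ls Us; pose e : rat := 10 ^- n.+1.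
have e_gt0 : 0 < e by rewrite invr_gt0 exprn_gt0.
have eqe : 10 ^- n = 10 * e.
  by rewrite /e exprS invfM mulrA divff // mul1r.
(* Twenty steps give [j <= 18]; the window found has centre [s + (j - 9) * e], hence the digit
   [j - 9]. *)
have Us' : ucut x (s - 10 ^- n + 20%:R * e).
  by move: Us; congr ucut; rewrite eqe; ring.
have [j le_j [Lj Uj]] := locator_refine e_gt0 Ls Us'.
have dP : -9 <= j%:Z - 9 <= 9 by lia.
exists (exist (fun d : int => is_true (-9 <= d <= 9)) _ dP); rewrite /near_cut /= -/e intrB -pmulrn.
split; [move: Lj|move: Uj]; congr (_ x _); rewrite eqe -?natr1; ring.
Qed.

(** The proof of [near_cut] travels with the approximation because choosing the next digit consumes
    it. *)
Fixpoint locator_approx (n : nat) : {s : rat | near_cut n s} :=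
  if n is m.+1 then
    let d := locator_digit (svalP (locator_approx m)) in
    exist (near_cut m.+1) _ (svalP d)
  else exist (near_cut 0) _ (svalP locator_int).

Definition locator_digits (n : nat) : digit :=
  sval (locator_digit (svalP (locator_approx n))).

Lemma locator_approxE n :
  sval (locator_approx n) =
    (sval locator_int)%:~R + digit_psum locator_digits n.
Proof.
elim: n => [|n IHn] /=; first by rewrite /digit_psum big_ord0 addr0.
by rewrite /digit_psum big_ord_recr addrA -IHn.
Qed.

Lemma near_cut_digits n :
  near_cut n ((sval locator_int)%:~R + digit_psum locator_digits n).
Proof. by rewrite -locator_approxE; apply: svalP. Qed.

Lemma locator_SDR : SDR x.
Proof.
apply: (@MkSDR x (sval locator_int) locator_digits).
apply: dedekind_sub_eq => [q /(lcut_rounded x q)|r /(ucut_rounded x r)].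
  case=> q' lt_q Lq'.
  (* Half of the gap absorbs the error [10 ^- n]; the other half keeps the partial sums uniformly
     above [q]. *)
  have e_gt0 : 0 < (q' - q) / 2 by lra.
  have [N small] := ltr_exp10 e_gt0.
  apply: (@lcut_addD_limD _ _ _ _ (q + (q' - q) / 2) N); first by lra.
  move=> n /small; have [_ Un] := near_cut_digits n.
  by have := cut_transitive Lq' Un; lra.
case=> r' lt_r Ur'.
have e_gt0 : 0 < (r - r') / 2 by lra.
have [N small] := ltr_exp10 e_gt0.
apply: (@ucut_addD_limD _ _ _ _ (r - (r - r') / 2) N); first by lra.
move=> n /small; have [Ln _] := near_cut_digits n.
by have := cut_transitive Ln Ur'; lra.
Qed.

End LocatorToSDR.

Theorem theorem3p36 (x : dedekind) :
  ((locator x -> SDR x) * (SDR x -> locator x))%type.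
Proof. exact: (@locator_SDR x, @SDR_locator x). Qed.
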